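(* Let $n=2$, $\mu>0$, $\kappa>0$, $k\ge \frac14$ and $\widehat{k}\ge \frac18$. Then the function $W_{\rm eH}:\mathbb{R}^{2\times 2}\to [0,+\infty]$ defined by $$W_{\rm eH}(F)=\begin{cases}\dfrac{\mu}{k}\,e^{k\,\|\mathrm{dev}_2\log U\|^2}+\dfrac{\kappa}{2\widehat{k}}\,e^{\widehat{k}\,[\log \det U]^2} & \text{if } \det F>0,\\[2mm] +\infty & \text{if }\det F\le 0,\end{cases}\qquad U=\sqrt{F^TF},$$ is rank-one convex.
   Context: $\log U$ is the principal (symmetric) logarithm of the symmetric positive definite matrix $U=\sqrt{F^TF}$. $\|X\|^2=\mathrm{tr}(XX^T)$ is the squared Frobenius norm and $\mathrm{dev}_n X=X-\frac1n\mathrm{tr}(X)\,I$ for $X\in\mathbb{R}^{n\times n}$, with $I$ the identity matrix. $\mathrm{GL}^+(n)=\{F\in\mathbb{R}^{n\times n}:\det F>0\}$. A function $W$ is rank-one convex on $\mathrm{GL}^+(n)$ if it is convex on every closed line segment contained in $\mathrm{GL}^+(n)$ whose end points differ by a matrix of rank one, i.e. $t\mapsto W(F+t\,\xi\otimes\eta)$ is convex for all $\xi,\eta\in\mathbb{R}^n$ on all closed intervals contained in $\{t: F+t\,\xi\otimes\eta\in \mathrm{GL}^+(n)\}$, where $(\xi\otimes\eta)_{ij}=\xi_i\eta_j$. (For $W_{\rm eH}$, which is $+\infty$ off $\mathrm{GL}^+(2)$, this is the same as convexity of $t\mapsto W_{\rm eH}(F+t\,\xi\otimes\eta)\in[0,+\infty]$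 on $\mathbb{R}$, since $\det$ is affine along rank-one lines.) *)

(* Defs.v *)
From HB Require Import structures.
From mathcomp Require Import all_boot all_order all_algebra.
From mathcomp Require Import all_classical all_reals all_analysis.

Set Implicit Arguments.
Unset Strict Implicit.
Unset Printing Implicit Defensive.

Import Order.TTheory GRing.Theory Num.Theory.
Local Open Scope classical_set_scope.
Local Open Scope ring_scope.

Definition mx_psd (R : realType) (n : nat) (A : 'M[R]_n) : Prop :=
  A^T = A /\ forall x : 'cV[R]_n, 0 <= (x^T *m A *m x) 0 0.

(* The positive semidefinite square root; it exists and is unique when A is
   positive semidefinite, so the choice made by xget is then immaterial. *)
Definition mx_sqrt (R : realType) (n : nat) (A : 'M[R]_n) : 'M[R]_n :=
  xget 0 [set B | mx_psd B /\ B *m B = A].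

(* log U = \sum_i ln (d_i) N_i (x) N_i, where the columns N_i of Q form an
   orthonormal eigenbasis of U with eigenvalues d_i > 0. Such a decomposition
   exists exactly when U is symmetric positive definite, and L does not depend
   on the decomposition chosen. *)
Definition mx_log (R : realType) (n : nat) (U : 'M[R]_n) : 'M[R]_n :=
  xget 0 [set L | exists (Q : 'M[R]_n) (d : 'rV[R]_n),
    [/\ Q^T *m Q = 1%:M, forall i, 0 < d 0 i,
        U = Q *m diag_mx d *m Q^T &
        L = Q *m diag_mx (map_mx (@ln R) d) *m Q^T]].

Definition sqr_frobenius (R : realType) (n : nat) (X : 'M[R]_n) : R :=
  \tr (X *m X^T).

Definition dev (R : realType) (n : nat) (X : 'M[R]_n) : 'M[R]_n :=
  X - (n%:R^-1 * \tr X)%:M.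

Definition GLplus (R : realType) (n : nat) : set 'M[R]_n :=
  [set F | 0 < \det F].

(* [convex_function] of the library is restricted to real-valued functions. *)
Definition ereal_convex_on (R : realType) (I : set R) (f : R -> \bar R) : Prop :=
  forall s t l : R, I s -> I t -> 0 <= l <= 1 ->
    (f (l * s + (1 - l) * t)%R <= l%:E * f s + (1 - l)%:E * f t)%E.

(* (xi *m eta^T) i j = xi_i * eta_j is the dyadic product of xi and eta. *)
Definition rank_one_convex_on (R : realType) (n : nat) (D : set 'M[R]_n)
    (W : 'M[R]_n -> \bar R) : Prop :=
  forall (F : 'M[R]_n) (xi eta : 'cV[R]_n) (a b : R),
    `[a, b] `<=` [set t | D (F + t *: (xi *m eta^T))] ->
    ereal_convex_on `[a, b] (fun t => W (F + t *: (xi *m eta^T))).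

Definition right_stretch (R : realType) (n : nat) (F : 'M[R]_n) : 'M[R]_n :=
  mx_sqrt (F^T *m F).

Definition W_eH (R : realType) (mu kappa k khat : R) (F : 'M[R]_2) : \bar R :=
  let U := right_stretch F in
  if 0 < \det F then
    (mu / k * expR (k * sqr_frobenius (dev (mx_log U)))
     + kappa / (2 * khat) * expR (khat * ln (\det U) ^+ 2))%:E
  else +oo%E.

(* Main.v *)
Require Import Defs.
From mathcomp Require Import all_boot all_order all_algebra.
From mathcomp Require Import all_classical all_reals all_analysis.
From mathcomp Require Import ring lra.
Import Order.TTheory GRing.Theory Num.Theory.
Import numFieldNormedType.Exports.
Local Open Scope classical_set_scope.
Local Open Scope ring_scope.

(** Let x >= y > 0 be the singular values of F, with det F = x y > 0. The
    deviatoric part of log U has eigenvalues +-(ln x - ln y) / 2, so that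
    |dev log U|^2 = ln^2 (x / y) / 2, while det U = det F. With
    g_c (r) = exp (c ln^2 r), the energy is therefore
      mu / k * g_(k/2) (x / y) + kappa / (2 khat) * g_khat (det F),
    see [log_right_stretch]. Both constants k / 2 and khat are at least 1 / 8,
    and 1 / 8 is exactly the threshold from which g_c is convex on the positive
    half-line ([expR_sqr_ln_convex]).

    The volumetric term is then convex on rank-one segments because the
    determinant is affine there. For the isochoric term, write the ratio of the
    singular values as x / y = x^2 / det F. The largest singular value x is a
    norm, hence a convex function of F, the map (a, u) |-> a^2 / u is jointly
    convex for u > 0 and increasing in a >= 0, and det F is affine, so x / y is
    convex on rank-one segments ([sv_ratio_rank_one_convex]). As x / y >= 1 and
    g_(k/2) is nondecreasing on [1, +oo[, composing the two keeps convexity.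

    What makes this elementary in dimension two is that x + y and x - y are
    Euclidean norms of linear functions of F ([sv_sum], [sv_diff]): this gives
    both the formula for x and its convexity. The square root of F^T F and the
    eigenbasis of U are likewise given by closed formulas; these are needed to
    know that the sets from which [mx_sqrt] and [mx_log] choose are inhabited. *)

(** * Convexity of exp (c ln^2 x) *)

Lemma positive_mean_value {R : realType} {f df : R -> R} {x y : R} :
  (forall z : R, 0 < z -> is_derive z 1 f (df z)) -> 0 < x -> x <= y ->
  exists c, x <= c <= y /\ f y - f x = df c * (y - x).
Proof.
move=> fdf x0 xy.
have pos (z : R) : z \in `[x, y] -> 0 < z.
  by rewrite in_itv /= => /andP[xz _]; apply: lt_le_trans xz.
have der : forall z : R, z \in `]x, y[ -> is_derive z 1 f (df z).
  by move=> z /subset_itv_oo_cc zxy; apply/fdf/pos.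
have cont : {within `[x, y], continuous f}.
  by apply: derivable_within_continuous => z /pos /fdf [].
have [c cxy fE] := MVT_segment xy der cont.
by exists c; split; first by move: cxy; rewrite in_itv.
Qed.

(** A nondecreasing derivative puts the graph above its tangents; convexity is
    the average of the two tangent inequalities based at the middle point. *)
Lemma positive_second_derivative_convex {R : realType} {f df ddf : R -> R} :
  (forall z : R, 0 < z -> is_derive z 1 f (df z)) ->
  (forall z : R, 0 < z -> is_derive z 1 df (ddf z)) ->
  (forall z : R, 0 < z -> 0 <= ddf z) ->
  forall x y l : R, 0 < x -> 0 < y -> 0 <= l <= 1 ->
    f (l * x + (1 - l) * y) <= l * f x + (1 - l) * f y.
Proof.
move=> fdf dfdd dd0.
have df_mono (x y : R) : 0 < x -> x <= y -> df x <= df y.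
  move=> x0 xy; have [c [/andP[xc cy] e]] := positive_mean_value dfdd x0 xy.
  rewrite -subr_ge0 e mulr_ge0 ?subr_ge0 //.
  by apply/dd0/(lt_le_trans x0).
have tangent (x y : R) : 0 < x -> 0 < y -> f x + df x * (y - x) <= f y.
  move=> x0 y0; case: (leP x y) => [xy|/ltW yx].
    have [c [/andP[xc cy] e]] := positive_mean_value fdf x0 xy.
    by rewrite -lerBrDl e ler_wpM2r ?subr_ge0 // df_mono.
  have [c [/andP[yc cx] e]] := positive_mean_value fdf y0 yx.
  have := ler_wpM2r (_ : 0 <= x - y) (df_mono c x (lt_le_trans y0 yc) cx).
  rewrite subr_ge0 => /(_ yx); rewrite -e; lra.
move=> x y l x0 y0 /andP[l0 l1]; set z := l * x + (1 - l) * y.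
have z0 : 0 < z by rewrite /z; nra.
have l1' : 0 <= 1 - l by rewrite subr_ge0.
have hx := ler_wpM2l l0 (tangent z x z0 x0).
have hy := ler_wpM2l l1' (tangent z y z0 y0).
(* the slopes cancel, because z is the average of x and y *)
apply: le_trans (lerD hx hy); rewrite le_eqVlt; apply/orP; left.
by apply/eqP; rewrite /z; ring.
Qed.

(** With L = ln x, the second derivative has the sign of 2 c L^2 - L + 1, a
    quadratic of discriminant 1 - 8 c in L: this is where 1 / 8 comes from. *)
Lemma expR_sqr_ln_convex {R : realType} {c : R} : 1 / 8 <= c ->
  forall x y l : R, 0 < x -> 0 < y -> 0 <= l <= 1 ->
    expR (c * ln (l * x + (1 - l) * y) ^+ 2)
      <= l * expR (c * ln x ^+ 2) + (1 - l) * expR (c * ln y ^+ 2).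
Proof.
move=> c8.
pose f (x : R) := expR (c * ln x ^+ 2).
pose df (x : R) := 2 * c * (ln x * x^-1 * f x).
pose ddf (x : R) := 2 * c * x^-1 ^+ 2 * f x * (2 * c * ln x ^+ 2 - ln x + 1).
have fdf (z : R) : 0 < z -> is_derive z 1 f (df z).
  move=> z0; have lnz := is_derive1_ln z0.
  have -> : f = expR \o (fun x => c *: (ln x * ln x)).
    by apply/funext => x; rewrite /f /= expr2.
  apply: is_derive_eq.
  by rewrite /df /f /= /GRing.scale /= expr2; ring.
have dfddf (z : R) : 0 < z -> is_derive z 1 df (ddf z).
  move=> z0; have lnz := is_derive1_ln z0.
  have fz := fdf z z0.
  have Vz : is_derive z 1 (fun x : R => x^-1) (- z ^- 2 *: 1).
    by apply: is_deriveV; rewrite gt_eqF.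
  have -> : df = (fun x => (2 * c) *: (ln x * x^-1 * f x)) by [].
  apply: is_derive_eq.
  rewrite /ddf /df /GRing.scale /=.
  move: (ln z) (f z) => L e; field.
  by rewrite gt_eqF.
have ddf0 (z : R) : 0 < z -> 0 <= ddf z.
  move=> z0.
  rewrite /ddf !mulr_ge0 ?expR_ge0 ?sqr_ge0 ?invr_ge0 ?(ltW z0) //; first lra.
  set L := ln z.
  (* 2 c L^2 - L + 1 >= L^2 / 4 - L + 1 = (L / 2 - 1)^2 *)
  have := sqr_ge0 (L / 2 - 1).
  have := ler_wpM2r (sqr_ge0 L) c8.
  lra.
exact: (positive_second_derivative_convex fdf dfddf ddf0).
Qed.

(** * The Euclidean norm of the plane *)

Definition hypot {R : rcfType} (x y : R) : R := Num.sqrt (x ^+ 2 + y ^+ 2).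

Lemma hypot_ge0 {R : rcfType} (x y : R) : 0 <= hypot x y.
Proof. exact: sqrtr_ge0. Qed.

Lemma sqr_hypot {R : rcfType} (x y : R) : hypot x y ^+ 2 = x ^+ 2 + y ^+ 2.
Proof. by rewrite sqr_sqrtr // addr_ge0 ?sqr_ge0. Qed.

Lemma hypot_cauchy_schwarz {R : rcfType} (x y x' y' : R) :
  x * x' + y * y' <= hypot x y * hypot x' y'.
Proof.
rewrite -sqrtrM ?addr_ge0 ?sqr_ge0 //.
apply: le_trans (ler_norm _) _; rewrite -sqrtr_sqr ler_wsqrtr //.
(* Lagrange's identity *)
rewrite -subr_ge0 (_ : _ - _ = (x * y' - y * x') ^+ 2) ?sqr_ge0 //; ring.
Qed.

Lemma hypot_sublinear {R : rcfType} (l m x y x' y' : R) : 0 <= l -> 0 <= m ->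
  hypot (l * x + m * x') (l * y + m * y') <= l * hypot x y + m * hypot x' y'.
Proof.
move=> l0 m0.
have S0 : 0 <= l * hypot x y + m * hypot x' y'.
  by rewrite addr_ge0 // mulr_ge0 ?hypot_ge0.
rewrite -(ler_pXn2r (_ : 0 < 2)%N) // ?nnegrE ?hypot_ge0 // sqr_hypot.
have -> : (l * hypot x y + m * hypot x' y') ^+ 2 =
    l ^+ 2 * (hypot x y ^+ 2) + 2 * (l * m) * (hypot x y * hypot x' y')
    + m ^+ 2 * (hypot x' y' ^+ 2) by ring.
rewrite !sqr_hypot.
have := ler_wpM2l (mulr_ge0 l0 m0) (hypot_cauchy_schwarz x y x' y').
move: (hypot x y * _) => P; nra.
Qed.

(** * Matrices of order two, entrywise *)

Lemma big_ord2 {R : nmodType} (f : 'I_2 -> R) : \sum_i f i = f 0 + f 1.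
Proof.
by rewrite !big_ord_recl big_ord0 addr0; congr (_ + f _); apply/val_inj.
Qed.

Lemma mulmx22 {R : nzRingType} m p (A : 'M[R]_(m, 2)) (B : 'M[R]_(2, p)) i j :
  (A *m B) i j = A i 0 * B 0 j + A i 1 * B 1 j.
Proof. by rewrite mxE big_ord2. Qed.

Lemma mxtrace_mx22 {R : nzRingType} (A : 'M[R]_2) : \tr A = A 0 0 + A 1 1.
Proof. exact: big_ord2. Qed.

Lemma det_mx22 {R : comNzRingType} (A : 'M[R]_2) :
  \det A = A 0 0 * A 1 1 - A 0 1 * A 1 0.
Proof.
rewrite (expand_det_row _ 0) big_ord2 /cofactor !det_mx11 !mxE /=.
rewrite /bump /= !expr0 expr1 mul1r mulN1r mulrN.
by congr (A _ _ * A _ _ - A _ _ * A _ _); apply/val_inj.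
Qed.

Lemma mx22_eq {T : Type} (A B : 'M[T]_2) :
  A 0 0 = B 0 0 -> A 0 1 = B 0 1 -> A 1 0 = B 1 0 -> A 1 1 = B 1 1 -> A = B.
Proof.
move=> e00 e01 e10 e11; apply/matrixP => i j.
have ord2 (h : 'I_2) : h = 0 \/ h = 1.
  by case: h => [[|[|]]] // ?; [left | right]; apply/val_inj.
by case: (ord2 i) => ->; case: (ord2 j) => ->.
Qed.

Lemma det_rank_one_affine {R : comNzRingType} (F : 'M[R]_2) (xi eta : 'cV[R]_2)
    (s t l : R) :
  \det (F + (l * s + (1 - l) * t) *: (xi *m eta^T))
  = l * \det (F + s *: (xi *m eta^T)) + (1 - l) * \det (F + t *: (xi *m eta^T)).
Proof.
by rewrite !det_mx22 !(mxE, big_ord_recl, big_ord0) /=; ring.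
Qed.

(** * Singular values of a matrix of order two *)

(** If x and y are the singular values of F and det F = x y >= 0, then
    (x + y)^2 = |F|^2 + 2 det F and (x - y)^2 = |F|^2 - 2 det F, and these two
    quadratic forms in F are sums of two squares. *)
Definition sv_sum {R : rcfType} (F : 'M[R]_2) : R :=
  hypot (F 0 0 + F 1 1) (F 0 1 - F 1 0).

Definition sv_diff {R : rcfType} (F : 'M[R]_2) : R :=
  hypot (F 0 0 - F 1 1) (F 0 1 + F 1 0).

Definition sv_max {R : rcfType} (F : 'M[R]_2) : R :=
  (sv_sum F + sv_diff F) / 2.

(** The quotient x / y of the singular values x >= y, as x^2 / (x y). *)
Definition sv_ratio {R : rcfType} (F : 'M[R]_2) : R := sv_max F ^+ 2 / \det F.

Lemma sv_max_ge0 {R : rcfType} (F : 'M[R]_2) : 0 <= sv_max F.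
Proof. by rewrite divr_ge0 // addr_ge0 ?hypot_ge0. Qed.

(** The largest singular value is half the sum of two seminorms. *)
Lemma sv_max_sublinear {R : rcfType} (A B : 'M[R]_2) (l m : R) :
  0 <= l -> 0 <= m ->
  sv_max (l *: A + m *: B) <= l * sv_max A + m * sv_max B.
Proof.
move=> l0 m0; rewrite /sv_max.
have -> : l * ((sv_sum A + sv_diff A) / 2) + m * ((sv_sum B + sv_diff B) / 2)
  = ((l * sv_sum A + m * sv_sum B) + (l * sv_diff A + m * sv_diff B)) / 2.
  by field.
rewrite ler_pM2r ?invr_gt0 //.
by apply: lerD; apply: le_trans (hypot_sublinear _ _ _ _ _ _ l0 m0);
  rewrite le_eqVlt; apply/orP; left; apply/eqP; congr hypot; rewrite !mxE; ring.
Qed.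

(** In terms of S = x + y and D = |x - y|, the claim x^2 >= x y reads
    ((S + D) / 2)^2 >= (S^2 - D^2) / 4. *)
Lemma sv_ratio_ge1 {R : rcfType} (F : 'M[R]_2) : 0 < \det F -> 1 <= sv_ratio F.
Proof.
move=> detF; rewrite /sv_ratio ler_pdivlMr // mul1r /sv_max.
have s2 := sqr_hypot (F 0 0 + F 1 1) (F 0 1 - F 1 0).
have d2 := sqr_hypot (F 0 0 - F 1 1) (F 0 1 + F 1 0).
have s0 := hypot_ge0 (F 0 0 + F 1 1) (F 0 1 - F 1 0).
have d0 := hypot_ge0 (F 0 0 - F 1 1) (F 0 1 + F 1 0).
rewrite -/(sv_sum F) in s2 s0; rewrite -/(sv_diff F) in d2 d0.
have -> : \det F = (sv_sum F ^+ 2 - sv_diff F ^+ 2) / 4.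
  by rewrite s2 d2 det_mx22; field.
nra.
Qed.

(** The right-hand side minus the left-hand side is l m (a v - b u)^2 / (u v (l u + m v)). *)
Lemma sqr_div_convex {R : realFieldType} (a b u v l m : R) :
  0 < u -> 0 < v -> 0 <= l -> 0 <= m -> 0 < l * u + m * v ->
  (l * a + m * b) ^+ 2 / (l * u + m * v) <= l * (a ^+ 2 / u) + m * (b ^+ 2 / v).
Proof.
move=> u0 v0 l0 m0 w0; rewrite ler_pdivrMr // -subr_ge0.
rewrite (_ : _ - _ = l * m * (a * v - b * u) ^+ 2 / (u * v)).
  by rewrite divr_ge0 ?(mulr_ge0 (mulr_ge0 l0 m0)) ?sqr_ge0
    ?mulr_ge0 ?(ltW u0) ?(ltW v0).
by field; rewrite !gt_eqF.
Qed.

Lemma sv_ratio_rank_one_convex {R : rcfType} (F : 'M[R]_2) (xi eta : 'cV[R]_2)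
    (s t l : R) :
  0 < \det (F + s *: (xi *m eta^T)) -> 0 < \det (F + t *: (xi *m eta^T)) ->
  0 <= l <= 1 ->
  sv_ratio (F + (l * s + (1 - l) * t) *: (xi *m eta^T))
  <= l * sv_ratio (F + s *: (xi *m eta^T))
     + (1 - l) * sv_ratio (F + t *: (xi *m eta^T)).
Proof.
move=> detA detB /andP[l0 l1].
have m0 : 0 <= 1 - l by rewrite subr_ge0.
have affine : F + (l * s + (1 - l) * t) *: (xi *m eta^T)
    = l *: (F + s *: (xi *m eta^T)) + (1 - l) *: (F + t *: (xi *m eta^T)).
  by apply/matrixP => i j; rewrite !mxE; ring.
have detE := det_rank_one_affine F xi eta s t l.
have detC : 0 < \det (F + (l * s + (1 - l) * t) *: (xi *m eta^T)).
  by rewrite detE; nra.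
rewrite {1}/sv_ratio detE; rewrite detE in detC.
apply: le_trans (sqr_div_convex _ _ _ _ _ _ detA detB l0 m0 detC).
rewrite ler_pM2r ?invr_gt0 // affine; set A := F + _; set B := F + _.
have max_le := sv_max_sublinear A B l (1 - l) l0 m0.
have max_ge0 := sv_max_ge0 (l *: A + (1 - l) *: B).
by rewrite ler_pXn2r ?nnegrE // (le_trans max_ge0).
Qed.

(** * Square root and logarithm *)

(** The eigenvalue d_i is the value of the quadratic form at the column i of
    Q. *)
Lemma psd_diag_ge0 {R : realType} {n} (Q : 'M[R]_n) (d : 'rV[R]_n) :
  Q^T *m Q = 1%:M -> mx_psd (Q *m diag_mx d *m Q^T) -> forall i, 0 <= d 0 i.
Proof.
move=> QQ [_ psd] i; have := psd (col i Q).
rewrite colE trmx_mul !mulmxA -(mulmxA _ Q^T Q) QQ mulmx1 -(mulmxA _ Q^T Q) QQ.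
by rewrite mulmx1 trmx_delta -rowE -colE !mxE eqxx.
Qed.

(** Write U = m I + [[h, b], [b, -h]] with m = (U00 + U11) / 2 and b = U01. The
    traceless part is s times a reflection, where s = sqrt (h^2 + b^2), and Q is
    the rotation whose angle is half the polar angle of (h, b). The vector
    (b, s - h) has that half angle, up to sign, unless b = 0, when it may vanish;
    but then U is already diagonal. *)
Lemma symmetric_mx22_diag {R : rcfType} (U : 'M[R]_2) : U^T = U ->
  exists (Q : 'M[R]_2) (d : 'rV[R]_2),
    Q^T *m Q = 1%:M /\ U = Q *m diag_mx d *m Q^T.
Proof.
move=> symU; have U10 : U 1 0 = U 0 1 by rewrite -{1}symU mxE.
have [U01|U01] := eqVneq (U 0 1) 0.
  exists 1%:M, (\row_j U j j); split; first by rewrite trmx1 mulmx1.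
  rewrite trmx1 mulmx1 mul1mx.
  by apply: mx22_eq; rewrite !mxE //= ?U10 U01.
pose h := (U 0 0 - U 1 1) / 2.
pose s := hypot h (U 0 1).
pose w := hypot (U 0 1) (s - h).
have s2 : s ^+ 2 = h ^+ 2 + U 0 1 ^+ 2 := sqr_hypot _ _.
have w2 : w ^+ 2 = U 0 1 ^+ 2 + (s - h) ^+ 2 := sqr_hypot _ _.
have w2_neq0 : w ^+ 2 != 0.
  by rewrite w2 gt_eqF // ltr_pwDl ?sqr_ge0 // exprn_even_gt0.
have w0 : w != 0 by rewrite -sqrf_eq0.
pose x := U 0 1 / w; pose y := (s - h) / w.
pose Q : 'M[R]_2 := \matrix_(i, j)
  if i == 0 then (if j == 0 then x else - y) else (if j == 0 then y else x).
pose m := (U 0 0 + U 1 1) / 2.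
pose d : 'rV[R]_2 := \row_j if j == 0 then m + s else m - s.
have U01E : U 0 1 ^+ 2 = s ^+ 2 - h ^+ 2 by lra.
have xy1 : x ^+ 2 + y ^+ 2 = 1.
  by rewrite /x /y !expr_div_n -mulrDl -w2 divff.
(* cosine and sine of the double angle, times s *)
have cos2 : s * (x ^+ 2 - y ^+ 2) = h.
  have : s * (U 0 1 ^+ 2 - (s - h) ^+ 2) = h * w ^+ 2.
    by rewrite w2 U01E; ring.
  move=> e; rewrite -[RHS](mulfK w2_neq0) -e /x /y; field; exact: w0.
have sin2 : s * (2 * x * y) = U 0 1.
  have : s * (2 * U 0 1 * (s - h)) = U 0 1 * w ^+ 2.
    by rewrite w2 U01E; ring.
  move=> e; rewrite -[RHS](mulfK w2_neq0) -e /x /y; field; exact: w0.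
exists Q, d; split.
  by apply: mx22_eq; rewrite mulmx22 !mxE /=; move: xy1; lra.
have mh0 : U 0 0 = m + h by rewrite /m /h; field.
have mh1 : U 1 1 = m - h by rewrite /m /h; field.
apply: mx22_eq; rewrite !mulmx22 !mxE /= ?U10 ?mh0 ?mh1.
- rewrite -cos2 -{1}[m]mulr1 -xy1; ring.
- rewrite -sin2; ring.
- rewrite -sin2; ring.
- rewrite -cos2 -{1}[m]mulr1 -xy1; ring.
Qed.

(** A positive semidefinite square root B of C = F^T F has det B = det F, so by
    the Cayley-Hamilton theorem (tr B) B = C + (det F) I; taking traces gives
    (tr B)^2 = |F|^2 + 2 det F, so that tr B = [sv_sum F]. This determines the
    witness. *)
Lemma mx_sqrt_gram {R : realType} (F : 'M[R]_2) : 0 < \det F ->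
  mx_psd (mx_sqrt (F^T *m F)) /\
  mx_sqrt (F^T *m F) *m mx_sqrt (F^T *m F) = F^T *m F.
Proof.
move=> detF.
pose t := sv_sum F; pose C := F^T *m F.
have t2 : t ^+ 2 = (F 0 0 + F 1 1) ^+ 2 + (F 0 1 - F 1 0) ^+ 2 := sqr_hypot _ _.
have t0 : 0 < t.
  rewrite lt0r hypot_ge0 andbT -sqrf_eq0 t2.
  move: detF; rewrite det_mx22 => detF.
  rewrite gt_eqF //.
  have := sqr_ge0 (F 0 0 - F 1 1); have := sqr_ge0 (F 0 1 + F 1 0); nra.
pose B : 'M[R]_2 := t^-1 *: (C + (\det F)%:M).
suff PB : mx_psd B /\ B *m B = C.
  exact: (xgetPex 0 (ex_intro [set B | mx_psd B /\ B *m B = C] B PB)).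
have CT : C^T = C by rewrite /C trmx_mul trmxK.
split; first split.
- by rewrite /B linearZ /= linearD /= CT tr_scalar_mx.
- move=> x; rewrite /B -scalemxAr -scalemxAl mxE.
  rewrite mulr_ge0 ?invr_ge0 ?(ltW t0) //.
  rewrite mulmxDr mulmxDl mxE addr_ge0 //.
    rewrite /C !mulmxA -trmx_mul -mulmxA.
    by rewrite mxE sumr_ge0 // => i _; rewrite mxE -expr2 sqr_ge0.
  rewrite mul_mx_scalar -scalemxAl mxE mulr_ge0 ?(ltW detF) //.
  by rewrite mxE sumr_ge0 // => i _; rewrite mxE -expr2 sqr_ge0.
- rewrite /B -scalemxAl -scalemxAr scalerA.
  suff -> : (C + (\det F)%:M) *m (C + (\det F)%:M) = t ^+ 2 *: C.
    by rewrite scalerA expr2 -invfM mulVf ?scale1r // mulf_neq0 // gt_eqF.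
  rewrite det_mx22 t2.
  by apply: mx22_eq; rewrite /C !(mulmx22, mxE) /= ?mulr1n ?mulr0n; ring.
Qed.

Lemma det_orthogonal_diag {R : realType} {n} (Q : 'M[R]_n) (d : 'rV[R]_n) :
  Q^T *m Q = 1%:M -> \det (Q *m diag_mx d *m Q^T) = \prod_i d 0 i.
Proof.
by move=> QQ; rewrite -mulmxA det_mulmx mulrC -det_mulmx -mulmxA QQ mulmx1 det_diag.
Qed.

(** The multiple of the identity subtracted by [dev] is diagonal in every
    orthonormal basis. *)
Lemma sqr_frobenius_dev_orthogonal_diag {R : realType} {n}
    (Q : 'M[R]_n) (d : 'rV[R]_n) :
  Q^T *m Q = 1%:M ->
  sqr_frobenius (dev (Q *m diag_mx d *m Q^T))
    = \sum_i (d 0 i - n%:R^-1 * \sum_j d 0 j) ^+ 2.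
Proof.
move=> QQ.
have trE (e : 'rV[R]_n) : \tr (Q *m diag_mx e *m Q^T) = \sum_i e 0 i.
  by rewrite mxtrace_mulC mulmxA QQ mul1mx mxtrace_diag.
rewrite /sqr_frobenius /dev trE; set m := n%:R^-1 * _.
have -> : Q *m diag_mx d *m Q^T - m%:M
    = Q *m diag_mx (d - const_mx m) *m Q^T.
  rewrite linearB /= diag_const_mx mulmxBr mulmxBl mul_mx_scalar -scalemxAl.
  by rewrite (mulmx1C QQ) scalemx1.
rewrite !trmx_mul trmxK tr_diag_mx !mulmxA -(mulmxA _ Q^T Q) QQ mulmx1.
rewrite -(mulmxA Q) mulmx_diag trE.
by apply: eq_bigr => i _; rewrite !mxE expr2.
Qed.

Lemma mxtrace_sqr_orthogonal_diag {R : realType} {n}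
    (Q : 'M[R]_n) (d : 'rV[R]_n) :
  Q^T *m Q = 1%:M ->
  \tr ((Q *m diag_mx d *m Q^T) *m (Q *m diag_mx d *m Q^T)) = \sum_i d 0 i ^+ 2.
Proof.
move=> QQ; rewrite !mulmxA -(mulmxA _ Q^T Q) QQ mulmx1 mxtrace_mulC !mulmxA QQ.
by rewrite mul1mx mulmx_diag mxtrace_diag; apply: eq_bigr => i _; rewrite mxE.
Qed.

(** The decomposition (P, e) that defines the logarithm need not be the given
    (Q, d), which only shows that there is one to choose. *)
Lemma mx_log_spec {R : realType} {n} (U : 'M[R]_n) (Q : 'M[R]_n) (d : 'rV[R]_n) :
  Q^T *m Q = 1%:M -> (forall i, 0 < d 0 i) -> U = Q *m diag_mx d *m Q^T ->
  exists (P : 'M[R]_n) (e : 'rV[R]_n),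
    [/\ P^T *m P = 1%:M, forall i, 0 < e 0 i, U = P *m diag_mx e *m P^T &
        mx_log U = P *m diag_mx (map_mx (@ln R) e) *m P^T].
Proof.
move=> QQ d0 UE.
apply: (@xgetPex _ 0 [set L | exists (P : 'M[R]_n) (e : 'rV[R]_n),
    [/\ P^T *m P = 1%:M, forall i, 0 < e 0 i, U = P *m diag_mx e *m P^T &
        L = P *m diag_mx (map_mx (@ln R) e) *m P^T]]).
by exists (Q *m diag_mx (map_mx (@ln R) d) *m Q^T); exists Q, d.
Qed.

(** The eigenvalues x, y > 0 of U satisfy x y = det F and x^2 + y^2 = |F|^2, so
    [sv_sum F] = x + y, [sv_diff F] = |x - y| and [sv_max F] = max x y. The ratio
    is then x / y or y / x, and both have the same squared logarithm. *)
Lemma log_right_stretch {R : realType} (F : 'M[R]_2) : 0 < \det F ->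
  \det (right_stretch F) = \det F /\
  sqr_frobenius (dev (mx_log (right_stretch F))) = ln (sv_ratio F) ^+ 2 / 2.
Proof.
move=> detF; have [psdU UU] := mx_sqrt_gram F detF.
rewrite -/(right_stretch F) in psdU UU; set U := right_stretch F in psdU UU *.
have [Q [d [QQ UE]]] := symmetric_mx22_diag U (proj1 psdU).
have detU2 : \det U ^+ 2 = \det F ^+ 2 by rewrite !expr2 -det_mulmx UU det_mulmx det_tr.
have d_ge0 : forall i, 0 <= d 0 i by apply: psd_diag_ge0 QQ _; rewrite -UE.
have d_gt0 i : 0 < d 0 i.
  rewrite lt0r d_ge0 andbT; apply/eqP => di0.
  have detU0 : \det U = 0 by rewrite UE det_orthogonal_diag // (bigD1 i) //= di0 mul0r.
  by move/eqP: detU2; rewrite detU0 expr0n /= eq_sym sqrf_eq0 gt_eqF.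
have [P [e [PP e_gt0 UE' ->]]] := mx_log_spec U Q d QQ d_gt0 UE.
move: (e_gt0 0) (e_gt0 1); set x := e 0 0; set y := e 0 1 => x0 y0.
have detU : \det U = x * y.
  rewrite UE' det_orthogonal_diag // !big_ord_recl big_ord0 mulr1.
  by congr (_ * e _ _); apply/val_inj.
have xyE : x * y = \det F.
  by apply/eqP; rewrite -(eqrXn2 (_ : 0 < 2)%N) ?ltW ?mulr_gt0 // -detU detU2.
have sumsq : x ^+ 2 + y ^+ 2 = F 0 0 ^+ 2 + F 0 1 ^+ 2 + F 1 0 ^+ 2 + F 1 1 ^+ 2.
  rewrite -(big_ord2 (fun i => e 0 i ^+ 2)) -(mxtrace_sqr_orthogonal_diag P) // -UE' UU.
  by rewrite mxtrace_mx22 !mulmx22 !mxE; ring.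
have sumE : sv_sum F = x + y.
  apply/eqP; rewrite -(eqrXn2 (_ : 0 < 2)%N) ?hypot_ge0 ?addr_ge0 ?ltW //.
  by rewrite sqr_hypot; apply/eqP; move: xyE; rewrite det_mx22; lra.
have diffE : sv_diff F = `|x - y|.
  apply/eqP; rewrite -(eqrXn2 (_ : 0 < 2)%N) ?hypot_ge0 ?normr_ge0 //.
  rewrite real_normK ?num_real //.
  by rewrite sqr_hypot; apply/eqP; move: xyE; rewrite det_mx22; lra.
split; first by rewrite detU.
rewrite sqr_frobenius_dev_orthogonal_diag // !big_ord2 !mxE -/x -/y.
have -> : ln (sv_ratio F) ^+ 2 = (ln x - ln y) ^+ 2.
  rewrite /sv_ratio /sv_max sumE diffE -maxr_absE -xyE.
  case: (leP y x) => _.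
    have -> : x ^+ 2 / (x * y) = x / y by field; rewrite !gt_eqF.
    by rewrite ln_div.
  have -> : y ^+ 2 / (x * y) = y / x by field; rewrite !gt_eqF.
  by rewrite ln_div //; ring.
by field.
Qed.

(** * Rank-one convexity of the energy *)

Theorem theorem5p21 (R : realType) (mu kappa k khat : R) :
  0 < mu -> 0 < kappa -> 1 / 4 <= k -> 1 / 8 <= khat ->
  rank_one_convex_on (@GLplus R 2) (W_eH mu kappa k khat).
Proof.
move=> mu0 kappa0 k4 kh8.
have ck : 0 <= mu / k by rewrite divr_ge0 ?ltW //; lra.
have ch : 0 <= kappa / (2 * khat) by rewrite divr_ge0 ?ltW //; lra.
move=> F xi eta a b abGL s t l abs abt l01.
have detA := abGL s abs; have detB := abGL t abt.
rewrite /= /GLplus /= in detA detB.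
have WE (G : 'M[R]_2) : 0 < \det G -> W_eH mu kappa k khat G =
    (mu / k * expR (k / 2 * ln (sv_ratio G) ^+ 2)
     + kappa / (2 * khat) * expR (khat * ln (\det G) ^+ 2))%:E.
  move=> detG; have [detU devU] := log_right_stretch G detG.
  rewrite /W_eH detG detU devU; congr ((_ * expR _ + _)%:E); ring.
have /andP[l0 l1] := l01.
have m0 : 0 <= 1 - l by rewrite subr_ge0.
have detE := det_rank_one_affine F xi eta s t l.
have detC : 0 < \det (F + (l * s + (1 - l) * t) *: (xi *m eta^T)).
  by rewrite detE; nra.
rewrite !WE // -!EFinM -EFinD lee_fin.
have rA := sv_ratio_ge1 _ detA; have rB := sv_ratio_ge1 _ detB.
have rC := sv_ratio_ge1 _ detC.
have pos (r : R) : 1 <= r -> 0 < r by apply: lt_le_trans.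
have k8 : 1 / 8 <= k / 2 by lra.
(* x / y is convex and at least 1, and g_(k/2) is nondecreasing and convex there *)
have iso : expR (k / 2 * ln (sv_ratio (F + (l * s + (1 - l) * t) *: (xi *m eta^T))) ^+ 2)
    <= l * expR (k / 2 * ln (sv_ratio (F + s *: (xi *m eta^T))) ^+ 2)
       + (1 - l) * expR (k / 2 * ln (sv_ratio (F + t *: (xi *m eta^T))) ^+ 2).
  have rle := sv_ratio_rank_one_convex F xi eta s t l detA detB l01.
  have rD := le_trans rC rle.
  have := expR_sqr_ln_convex k8 _ _ l (pos _ rA) (pos _ rB) l01.
  apply: le_trans; rewrite ler_expR ler_wpM2l //; first lra.
  by rewrite ler_pXn2r ?nnegrE ?ln_ge0 // ler_ln ?posrE ?pos.
have vol := expR_sqr_ln_convex kh8 _ _ l detA detB l01.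
rewrite -detE in vol.
apply: le_trans (lerD (ler_wpM2l ck iso) (ler_wpM2l ch vol)) _.
rewrite le_eqVlt; apply/orP; left; apply/eqP.
by do 4!move: (expR _) => ?; ring.
Qed.
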